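(* Let $d\ge1$ and $0\le l\le d$. Then \[\sum_{n\ge0}\left|n[-1,1]^d_l\cap\mathbb{Z}^d\right|t^n=\frac{B_{l+1}(d+1,t)}{(1-t)^{d+1}}.\]
   Context: $[-1,1]^d_l=[-1,1]^d\setminus\{x: x_i=1\text{ for some }i\in\{d+1-l,\dots,d\}\}$ and, for $n\ge0$, $n[-1,1]^d_l=[-n,n]^d\setminus\{x:x_i=n\text{ for some }i\ge d+1-l\}$ (empty for $n=0$, $l\ge1$). A signed permutation of $[m]$ is a pair $(\sigma,\epsilon)$ with $\sigma\in S_m$, $\epsilon\in\{\pm1\}^m$; $B_m$ is the set of these. Set $\sigma_0=0$, $\epsilon_0=1$; $\operatorname{des}(\sigma,\epsilon)=|\{i\in\{0,\dots,m-1\}:\epsilon_i\sigma_i>\epsilon_{i+1}\sigma_{i+1}\}|$. For $1\le k\le m$, $B_k(m,t)=\sum t^{\operatorname{des}(\sigma,\epsilon)}$ over $(\sigma,\epsilon)\in B_m$ with $\epsilon_m\sigma_m=m+1-k$. *)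

(* Defs.v *)
From HB Require Import structures.
From mathcomp Require Import all_boot all_order all_algebra all_fingroup.
From mathcomp Require Import finmap.
From mathcomp Require Import all_classical all_reals.

Set Implicit Arguments.
Unset Strict Implicit.
Unset Printing Implicit Defensive.

Import Order.TTheory GRing.Theory Num.Theory.
Local Open Scope ring_scope.

Definition fps (R : Type) := nat -> R.

Definition fps_of_poly (R : nzRingType) (p : {poly R}) : fps R :=
  fun n => p`_n.

Definition fps_mul (R : nzRingType) (a b : fps R) : fps R :=
  fun n => \sum_(i < n.+1) a (n - i)%N * b i.

(* The first n + 1 coefficients of the inverse series, by the recursion
   b_0 = a_0^-1 and b_n = - a_0^-1 * \sum_(i < n) a_(n-i) * b_i. *)
Fixpoint fps_inv_coefs (R : unitRingType) (a : fps R) (n : nat) : seq R :=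
  if n is n'.+1 then
    let s := fps_inv_coefs a n' in
    rcons s (- (a 0%N)^-1 * \sum_(i < n) a (n - i)%N * s`_i)
  else [:: (a 0%N)^-1].

Definition fps_inv (R : unitRingType) (a : fps R) : fps R :=
  fun n => (fps_inv_coefs a n)`_n.

Definition fps_div (R : unitRingType) (a b : fps R) : fps R :=
  fps_mul a (fps_inv b).

Lemma size_fps_inv_coefs (R : unitRingType) (a : fps R) (n : nat) :
  size (fps_inv_coefs a n) = n.+1.
Proof. by elim: n => //= n IHn; rewrite size_rcons IHn. Qed.

Lemma nth_fps_inv_coefs (R : unitRingType) (a : fps R) (n i : nat) :
  (i <= n)%N -> (fps_inv_coefs a n)`_i = fps_inv a i.
Proof.
elim: n => [|n IHn]; first by rewrite leqn0 => /eqP ->.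
rewrite leq_eqVlt => /predU1P[-> //|lt_in].
by rewrite [fps_inv_coefs a n.+1]/= nth_rcons size_fps_inv_coefs lt_in IHn.
Qed.

Lemma fps_mulV (R : unitRingType) (a : fps R) :
  a 0%N \is a GRing.unit -> fps_mul a (fps_inv a) =1 fps_of_poly 1.
Proof.
move=> a0U [|n]; rewrite /fps_mul /fps_of_poly coef1 big_ord_recr /=.
  by rewrite big_ord0 add0r subnn /fps_inv /= divrr.
rewrite subnn /fps_inv /= nth_rcons size_fps_inv_coefs ltnn eqxx.
rewrite mulrA mulrN divrr // mulN1r.
apply/eqP; rewrite subr_eq0; apply/eqP/eq_bigr => i _.
by rewrite !nth_fps_inv_coefs // -ltnS.
Qed.

Section HalfOpenCube.
Local Open Scope classical_set_scope.

(* Coordinates are numbered from 0, so the i-th coordinate of the text,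
   1 <= i <= d, is the one with index i - 1. *)
Definition half_open_cube (R : realType) (d l n : nat) : set 'rV[R]_d :=
  [set x : 'rV[R]_d | forall i, - n%:R <= x ord0 i <= n%:R] `\`
  [set x : 'rV[R]_d | exists2 i : 'I_d, (d.+1 - l <= i.+1)%N & x ord0 i = n%:R].

#[global] Arguments half_open_cube : clear implicits.

Definition lattice_points (R : realType) (d : nat) : set 'rV[R]_d :=
  [set x : 'rV[R]_d | forall i, x ord0 i \is a Num.int].

#[global] Arguments lattice_points : clear implicits.

(* fset_set sends infinite sets to the empty finite set; this does not occur
   here, see cube_points_finite below. *)
Definition ncube_points (R : realType) (d l n : nat) : nat :=
  #|` fset_set (half_open_cube R d l n `&` lattice_points R d) |%fset.

Lemma cube_points_finite (R : realType) (d l n : nat) :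
  finite_set (half_open_cube R d l n `&` lattice_points R d).
Proof.
pose f (g : {ffun 'I_d -> 'I_(n + n).+1}) : 'rV[R]_d :=
  \row_i ((g i)%:R - n%:R).
apply: (@sub_finite_set _ _ (f @` setT)); last exact/finite_image/finite_finset.
move=> x [[xn _] xZ].
have h i : exists k : 'I_(n + n).+1, x ord0 i = k%:R - n%:R.
  have /andP[lo hi] := xn i; have /intrP[z xz] := xZ i.
  have z0 : 0 <= z + n%:Z.
    by rewrite -(ler_int R) intrD -xz -lerBlDr sub0r.
  have zn : (`|(z + n%:Z)%R| < (n + n).+1)%N.
    rewrite ltnS -lez_nat gez0_abs // PoszD lerD2r -(ler_int R) -xz //.
  exists (Ordinal zn) => /=.
  by rewrite natr_absz ger0_norm // intrD -xz addrK.
have [g gE] := choice h.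
exists [ffun i => g i] => //; apply/rowP => i.
by rewrite !mxE ffunE -gE.
Qed.

End HalfOpenCube.

(* In (s, e), the sign of position i is (-1) ^+ e i, and s acts on
   {0, ..., m-1} instead of {1, ..., m}. *)
Definition signed_perm (m : nat) : finType := ('S_m * {ffun 'I_m -> bool})%type.

(* sp_val w i is epsilon_i * sigma_i for 0 <= i <= m, with value 0 at i = 0. *)
Definition sp_val (m : nat) (w : signed_perm m) (i : 'I_m.+1) : int :=
  if unlift ord0 i is Some j then (-1) ^+ w.2 j * (w.1 j).+1%:Z else 0.

Definition des (m : nat) (w : signed_perm m) : nat :=
  #|[set i : 'I_m |
      sp_val w (lift ord0 i) < sp_val w (widen_ord (leqnSn m) i)]|.

Definition Bpoly (k m : nat) : {poly int} :=
  \sum_(w : signed_perm m | sp_val w ord_max == m.+1%:Z - k%:Z) 'X^(des w).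

(* Main.v *)
Require Import Defs.
From HB Require Import structures.
From mathcomp Require Import all_boot all_order all_algebra all_fingroup.
From mathcomp Require Import finmap.
From mathcomp Require Import all_classical all_reals.
From mathcomp Require Import zify ring.

Set Implicit Arguments.
Unset Strict Implicit.
Unset Printing Implicit Defensive.

Import Order.TTheory GRing.Theory Num.Theory.
Local Open Scope ring_scope.

(**
Count signed permutations of [m + 1] by their last letter.  Deleting the last
letter and standardizing turns the descent polynomial with prescribed last
letter p into the sum of the descent polynomials on [m], each multiplied by
t exactly when the new last step is a descent.  On the other side, with last
letter +(j + 1) the series coefficient is (2n + 1)^j (2n)^(m - j), and with last
letter -(j + 1) it is (2n - 1)^j (2n)^(m - j) for n > 0 (and 0 for n = 0), as
predicted by reciprocity from w |-> -w.  Both 2n + 1 and 2n - 1 are neighbours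
of 2n, so the sums over the deleted letter telescope and give back the first
difference of the coefficients one dimension up, that is, multiplication of the
series by 1 - t.
*)

(** * Formal power series: ring laws, division, and multiplication by 1 - X *)

(** A coefficient of degree below N only sees truncations, so commutativity and associativity of
    [fps_mul] can be borrowed from polynomials. *)
Lemma fps_mul_trunc (R : comNzRingType) (a b : fps R) (N n : nat) : (n < N)%N ->
  fps_mul a b n = ((\poly_(i < N) a i) * (\poly_(i < N) b i))`_n.
Proof.
move=> ltnN; rewrite coefMr; apply: eq_bigr => i _.
by rewrite !coef_poly (leq_ltn_trans (leq_subr i n) ltnN)
           (leq_ltn_trans _ ltnN) // -ltnS.
Qed.

Lemma fps_mulC (R : comNzRingType) (a b : fps R) : fps_mul a b = fps_mul b a.
Proof. by apply/funext => n; rewrite !(fps_mul_trunc _ _ (ltnSn n)) mulrC. Qed.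

Lemma fps_mulA (R : comNzRingType) (a b c : fps R) :
  fps_mul a (fps_mul b c) = fps_mul (fps_mul a b) c.
Proof.
apply/funext => n; pose T (f : fps R) := \poly_(i < n.+1) f i.
transitivity ((T a * (T b * T c))`_n).
  rewrite coefMr; apply: eq_bigr => i _.
  by rewrite coef_poly ltnS leq_subr (fps_mul_trunc _ _ (ltn_ord i)).
rewrite mulrA coefM fps_mulC; apply: eq_bigr => i _.
by rewrite mulrC (fps_mul_trunc _ _ (ltn_ord i)) coef_poly ltnS leq_subr.
Qed.

Lemma fps_of_polyM (R : nzRingType) (p q : {poly R}) :
  fps_of_poly (p * q) = fps_mul (fps_of_poly p) (fps_of_poly q).
Proof. by apply/funext => n; rewrite /fps_of_poly coefMr. Qed.

Lemma fps_mul1 (R : nzRingType) (a : fps R) : fps_mul a (fps_of_poly 1) = a.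
Proof.
apply/funext => n; rewrite /fps_mul big_ord_recl big1 => [|i _] /=;
  by rewrite /fps_of_poly coef1 ?mulr0 // subn0 mulr1 addr0.
Qed.

Lemma fps_mul_suml (R : nzRingType) (I : finType) (a : I -> fps R) (b : fps R) :
  fps_mul (fun n => \sum_i a i n) b = (fun n => \sum_i fps_mul (a i) b n).
Proof.
apply/funext => n; rewrite /fps_mul exchange_big.
by apply: eq_bigr => i _; rewrite mulr_suml.
Qed.

Lemma fps_mulBr (R : nzRingType) (a : fps R) (p q : {poly R}) (n : nat) :
  fps_mul a (fps_of_poly (p - q)) n =
  fps_mul a (fps_of_poly p) n - fps_mul a (fps_of_poly q) n.
Proof.
by rewrite -sumrB; apply: eq_bigr => i _; rewrite /fps_of_poly coefB mulrBr.
Qed.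

Lemma fps_divE (R : comUnitRingType) (a b c : fps R) :
  b 0%N \is a GRing.unit -> fps_mul a b = c -> a = fps_div c b.
Proof.
move=> b0U <-; have {}b0U : fps_mul b (fps_inv b) = fps_of_poly 1 by apply/funext/fps_mulV.
by rewrite /fps_div -fps_mulA b0U fps_mul1.
Qed.

Definition fps_shift (R : nzRingType) (a : fps R) : fps R :=
  fun n => if n is n'.+1 then a n' else 0.

Lemma fps_mulX (R : nzRingType) (a : fps R) :
  fps_mul a (fps_of_poly 'X) = fps_shift a.
Proof.
apply/funext => -[|n]; rewrite /fps_mul /fps_of_poly.
  by rewrite big_ord1 coefX mulr0.
rewrite !big_ord_recl big1 => [|i _] /=; rewrite !coefX ?mulr0 //=.
by rewrite subSS subn0 mulr1 addr0 add0r.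
Qed.

Lemma fps_mulXb (R : nzRingType) (a : fps R) (c : bool) :
  fps_mul a (fps_of_poly 'X^c) = if c then fps_shift a else a.
Proof. by case: c; rewrite /= ?expr0 ?fps_mul1 // fps_mulX. Qed.

Lemma fps_mul1BX (R : nzRingType) (a : fps R) (n : nat) :
  fps_mul a (fps_of_poly (1 - 'X)) n = a n - fps_shift a n.
Proof. by rewrite fps_mulBr fps_mul1 fps_mulX. Qed.

(** * Lattice counts and their first-difference recursion *)

(* A pair (j, b) stands for the letter (-1)^b * (j + 1).  The letter (j', b') is
   compared with (j, b) after the letters of absolute value at least j + 1 have
   been moved away from 0 to make room for (j, b); see last_descentE. *)
Definition last_descent (j : nat) (b : bool) (j' : nat) (b' : bool) : bool :=
  if b then ~~ b' || (j' < j)%N else ~~ b' && (j <= j')%N.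

(** For n > 0, a positive letter gives the number of lattice points in a product of j closed and m -
    j half-open intervals; a negative letter has j open intervals instead of the closed ones. The
    factor [(n != 0%N)%:R] matters when j = m, where the product at n = 0 would be (-1)^m rather
    than 0. *)
Definition cube_count (m j : nat) (b : bool) : fps int := fun n =>
  if b then (n != 0%N)%:R * ((n.*2%:Z - 1) ^+ j * n.*2%:Z ^+ (m - j))
  else (n.*2%:Z + 1) ^+ j * n.*2%:Z ^+ (m - j).

Section Telescope.
Variables (R : comNzRingType) (y z : R) (m j : nat).
Hypothesis le_jm : (j <= m.+1)%N.
Let g (i : nat) := y ^+ i * z ^+ (m.+1 - i).

Let gS (i : 'I_m.+1) : (y - z) * (y ^+ i * z ^+ (m - i)) = g i.+1 - g i.
Proof. by rewrite /g subSS subSn -1?ltnS // !exprS; ring. Qed.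

(** Each term times y - z is a difference of consecutive values of [g]. In the application y is z +
    1 or z - 1, so the factor y - z is a mere sign. *)
Lemma sum_geometric_ltn :
  (y - z) * (\sum_(i < m.+1 | (i < j)%N) y ^+ i * z ^+ (m - i)) =
  y ^+ j * z ^+ (m.+1 - j) - z ^+ m.+1.
Proof.
rewrite mulr_sumr (eq_bigr _ (fun i _ => gS i)).
rewrite -(big_ord_widen _ (fun i => g i.+1 - g i)) //.
rewrite -(big_mkord xpredT (fun i => g i.+1 - g i)) telescope_sumr // /g.
by rewrite expr0 mul1r subn0.
Qed.

Lemma sum_geometric_geq :
  (y - z) * (\sum_(i < m.+1 | (j <= i)%N) y ^+ i * z ^+ (m - i)) =
  y ^+ m.+1 - y ^+ j * z ^+ (m.+1 - j).
Proof.
have: (y - z) * (\sum_(i < m.+1) y ^+ i * z ^+ (m - i)) =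
      y ^+ m.+1 - z ^+ m.+1.
  rewrite mulr_sumr (eq_bigr _ (fun i _ => gS i)).
  rewrite -(big_mkord xpredT (fun i => g i.+1 - g i)) telescope_sumr // /g.
  by rewrite expr0 mul1r subn0 subnn expr0 mulr1.
rewrite (bigID (fun i : 'I_m.+1 => (i < j)%N)) /= mulrDr sum_geometric_ltn.
under [X in _ + _ * X]eq_bigl do rewrite -leqNgt.
by move/(canRL (addKr _)) ->; ring.
Qed.

End Telescope.

Lemma cube_count_rec (m j : nat) (b : bool) (n : nat) : (j <= m.+1)%N ->
  cube_count m.+1 j b n - fps_shift (cube_count m.+1 j b) n =
  \sum_(p : 'I_m.+1 * bool)
    fps_mul (cube_count m p.1 p.2) (fps_of_poly 'X^(last_descent j b p.1 p.2)) n.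
Proof.
move=> le_jm.
rewrite -(pair_bigA _ (fun (i : 'I_m.+1) c => fps_mul (cube_count m i c)
  (fps_of_poly 'X^(last_descent j b i c)) n)) /=.
under eq_bigr do rewrite big_bool /= !fps_mulXb !(fun_if (@^~ n)).
rewrite big_split /= !big_if /=.
(* Here z stands for twice the dilation factor; z + 1 belongs to positive deleted letters, z - 1 to
   negative ones. *)
have lt_up z : \sum_(i < m.+1 | (i < j)%N) (z + 1) ^+ i * z ^+ (m - i) =
    (z + 1) ^+ j * z ^+ (m.+1 - j) - z ^+ m.+1 :> int.
  by rewrite -sum_geometric_ltn // addrAC subrr add0r mul1r.
have ge_up k z : (k <= m.+1)%N ->
    \sum_(i < m.+1 | (k <= i)%N) (z + 1) ^+ i * z ^+ (m - i) =
    (z + 1) ^+ m.+1 - (z + 1) ^+ k * z ^+ (m.+1 - k) :> int.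
  by move=> le_km; rewrite -sum_geometric_geq // addrAC subrr add0r mul1r.
have lt_dn z : \sum_(i < m.+1 | (i < j)%N) (z - 1) ^+ i * z ^+ (m - i) =
    z ^+ m.+1 - (z - 1) ^+ j * z ^+ (m.+1 - j) :> int.
  apply: oppr_inj.
  by rewrite opprB -sum_geometric_ltn // addrAC subrr add0r mulN1r.
have ge_dn k z : (k <= m.+1)%N ->
    \sum_(i < m.+1 | (k <= i)%N) (z - 1) ^+ i * z ^+ (m - i) =
    (z - 1) ^+ k * z ^+ (m.+1 - k) - (z - 1) ^+ m.+1 :> int.
  move=> le_km; apply: oppr_inj.
  by rewrite opprB -sum_geometric_geq // addrAC subrr add0r mulN1r.
have all_up z : \sum_(i < m.+1) (z + 1) ^+ i * z ^+ (m - i) =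
    (z + 1) ^+ m.+1 - z ^+ m.+1 :> int.
  by rewrite -[z ^+ m.+1]mul1r; apply: (ge_up 0%N).
have all_dn z : \sum_(i < m.+1) (z - 1) ^+ i * z ^+ (m - i) =
    z ^+ m.+1 - (z - 1) ^+ m.+1 :> int.
  by rewrite -[z ^+ m.+1]mul1r; apply: (ge_dn 0%N).
(* Negative letters at n + 1 and positive letters at n share the base 2n + 1, so the boundary powers
   (2n + 1)^(m + 1) cancel. *)
have sh (i : nat) : i.+1.*2%:Z - 1 = i.*2%:Z + 1 by lia.
case: b => /=; last first.
  rewrite big_pred0 // add0r.
  under [X in _ = _ + (_ + X)]eq_bigl do rewrite -ltnNge.
  case: n => [|n]; rewrite /= /cube_count /=.
    rewrite lt_up big1 => [|i _]; last by rewrite mul0r.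
    by rewrite big1 // double0 [0 ^+ m.+1]expr0n /= !subr0 !add0r.
  rewrite lt_up ge_up //; under eq_bigr do rewrite mul1r.
  by rewrite all_dn sh; ring.
rewrite [X in _ = _ + (_ + X)]big_pred0 // addr0.
under [X in _ = _ + X + _]eq_bigl do rewrite -leqNgt.
case: n => [|n]; rewrite /= /cube_count /=.
  by rewrite !big1 // ?mul0r // => i _; rewrite mul0r.
under [X in _ = _ + X + _]eq_bigr do rewrite mul1r.
rewrite ge_dn // all_up -mulr_sumr lt_dn sh.
(* The shifted negative terms vanish at n = 0, so there (2n)^(m + 1) has nothing to cancel against;
   it is 0 itself. *)
case: n => [|n] /=; last by ring.
by rewrite double0 [0 ^+ m.+1]expr0n /=; ring.
Qed.

(** * Deleting and appending the last letter *)

Definition sp_last (m : nat) (w : signed_perm m.+1) : 'I_m.+1 * bool :=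
  (w.1 ord_max, w.2 ord_max).

(** Inverse of deletion with standardization: [lift_perm] sends the last position to [p.1] and
    raises the values of [w] from [p.1] on by one. *)
Definition sp_rcons (m : nat) (p : 'I_m.+2 * bool) (w : signed_perm m.+1) :
    signed_perm m.+2 :=
  (lift_perm ord_max p.1 w.1,
   [ffun i => if unlift ord_max i is Some k then w.2 k else p.2]).

Lemma sp_last_rcons (m : nat) (p : 'I_m.+2 * bool) (w : signed_perm m.+1) :
  sp_last (sp_rcons p w) = p.
Proof.
by case: p => j b; rewrite /sp_last /= lift_perm_id ffunE unlift_none.
Qed.

Lemma sp_rcons_inj (m : nat) (p : 'I_m.+2 * bool) : injective (@sp_rcons m p).
Proof.
move=> [s e] [s' e'] [/permP ss' /ffunP ee']; congr (_, _).
  apply/permP => i; have := ss' (lift ord_max i).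
  by rewrite !lift_perm_lift => /lift_inj.
by apply/ffunP => i; have := ee' (lift ord_max i); rewrite !ffunE liftK.
Qed.

Lemma sp_rcons_surj (m : nat) (w : signed_perm m.+2) :
  exists w', w = sp_rcons (sp_last w) w'.
Proof.
case: w => s e.
have liftP (k : 'I_m.+1) : s ord_max != s (lift ord_max k).
  by rewrite (inj_eq perm_inj) neq_lift.
(* [f] is the standardized remainder; by [liftP] the default [ord_max] is never taken. *)
pose f k := odflt ord_max (unlift (s ord_max) (s (lift ord_max k))).
have fE k : lift (s ord_max) (f k) = s (lift ord_max k).
  by rewrite /f; have [i -> ->] := unlift_some (liftP k).
have f_inj : injective f.
  move=> i k fik; apply/(@lift_inj _ ord_max)/(@perm_inj _ s).
  by rewrite -!fE fik.
exists (perm f_inj, [ffun k => e (lift ord_max k)]); congr (_, _) => /=.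
  apply/permP => i; case: (unliftP ord_max i) => [k|] ->.
    by rewrite lift_perm_lift permE fE.
  by rewrite lift_perm_id.
by apply/ffunP => i; rewrite ffunE; case: unliftP => [k|] ->; rewrite ?ffunE.
Qed.

(** * Descents after appending a letter *)

Definition signed_val (p : nat * bool) : int := (-1) ^+ p.2 * p.1.+1%:Z.

(** Effect on the earlier letters of appending a letter of absolute value j + 1, extended to all
    integers. The map is strictly increasing and fixes 0, so earlier descents survive, including one
    at the initial 0. *)
Definition insert_gap (j : nat) (z : int) : int :=
  if j%:Z < z then z + 1 else if z < - j%:Z then z - 1 else z.

Lemma insert_gap_mono (j : nat) : {mono insert_gap j : x y / x < y}.
Proof. by move=> x y; rewrite /insert_gap; do !case: ifP; lia. Qed.

Lemma insert_gap_val (j k : nat) (b : bool) :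
  insert_gap j (signed_val (k, b)) = signed_val (bump j k, b).
Proof.
rewrite /insert_gap /signed_val /bump /=; case: b => /=;
  rewrite ?expr1 ?expr0 ?mul1r ?mulN1r; do !case: ifP; case: leqP; lia.
Qed.

Lemma last_descentE (j : nat) (b : bool) (j' : nat) (b' : bool) :
  (signed_val (j, b) < insert_gap j (signed_val (j', b'))) = last_descent j b j' b'.
Proof.
rewrite insert_gap_val /signed_val /last_descent /bump /=.
case: b; case: b' => /=; rewrite ?expr1 ?expr0 ?mul1r ?mulN1r;
  case: (leqP j j'); lia.
Qed.

Lemma sp_val_lift (m : nat) (w : signed_perm m) (i : 'I_m) :
  sp_val w (lift ord0 i) = signed_val (val (w.1 i), w.2 i).
Proof. by rewrite /sp_val liftK. Qed.

Lemma sp_val_max (m : nat) (w : signed_perm m.+1) :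
  sp_val w ord_max = signed_val (val (sp_last w).1, (sp_last w).2).
Proof.
have -> : ord_max = lift ord0 (ord_max : 'I_m.+1) by apply: val_inj.
exact: sp_val_lift.
Qed.

Lemma sp_val_rcons (m : nat) (p : 'I_m.+2 * bool) (w : signed_perm m.+1)
    (i : 'I_m.+2) :
  sp_val (sp_rcons p w) (widen_ord (leqnSn _) i) = insert_gap p.1 (sp_val w i).
Proof.
case: (unliftP ord0 i) => [k|] ->; last first.
  rewrite (_ : widen_ord _ _ = ord0); last exact: val_inj.
  by rewrite /sp_val !unlift_none /insert_gap oppr_gt0 !ltz_nat !ltn0.
rewrite (_ : widen_ord _ _ = lift ord0 (lift ord_max k)); last first.
  by apply: val_inj; congr (bump 0); exact: esym (lift_max k).
by rewrite !sp_val_lift insert_gap_val /= lift_perm_lift ffunE liftK.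
Qed.

Lemma des_sum (m : nat) (w : signed_perm m) :
  des w = (\sum_(i < m)
    (sp_val w (lift ord0 i) < sp_val w (widen_ord (leqnSn m) i))%R)%N.
Proof.
rewrite /des -sum1_card big_mkcond.
by apply: eq_bigr => i _; rewrite inE; case: ifP.
Qed.

Lemma des_rcons (m : nat) (p : 'I_m.+2 * bool) (w : signed_perm m.+1) :
  des (sp_rcons p w) =
  (des w + last_descent p.1 p.2 (sp_last w).1 (sp_last w).2)%N.
Proof.
rewrite !des_sum big_ord_recr /=; congr (_ + _)%N.
  apply: eq_bigr => i _.
  rewrite (_ : lift ord0 _ = widen_ord (leqnSn _) (lift ord0 i)).
    by rewrite !sp_val_rcons insert_gap_mono.
  by apply: val_inj.
rewrite (_ : lift ord0 ord_max = ord_max); last exact: val_inj.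
by rewrite sp_val_rcons !sp_val_max sp_last_rcons last_descentE.
Qed.

(** * Descent polynomials by last letter and their series *)

Definition des_poly (m : nat) (p : 'I_m.+1 * bool) : {poly int} :=
  \sum_(w : signed_perm m.+1 | sp_last w == p) 'X^(des w).

Lemma des_poly0 (p : 'I_1 * bool) : des_poly p = 'X^(p.2).
Proof.
case: p => j b; rewrite /des_poly /=.
rewrite (big_pred1 ((1%g, [ffun=> b]) : signed_perm 1)) => [|[s e]].
  rewrite des_sum big_ord1 sp_val_lift.
  rewrite (_ : widen_ord _ _ = ord0); last exact: val_inj.
  by rewrite /sp_val unlift_none ffunE perm1 /signed_val /=; case: b.
rewrite /sp_last /= !xpair_eqE; congr (_ && _).
  rewrite !(ord1 _, eqxx).
  by apply/esym/eqP/permP => i; rewrite !ord1.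
apply/eqP/eqP => [<-|->]; last by rewrite ffunE.
by apply/ffunP => i; rewrite ffunE !ord1; congr (e _); apply: val_inj.
Qed.

(** [sp_rcons p] is a bijection onto the words ending in [p]; its arguments are grouped by their own
    last letter. *)
Lemma des_polyS (m : nat) (p : 'I_m.+2 * bool) :
  des_poly p =
  \sum_(q : 'I_m.+1 * bool) des_poly q * 'X^(last_descent p.1 p.2 q.1 q.2).
Proof.
transitivity (\sum_(w : signed_perm m.+1) 'X^(des (sp_rcons p w)) : {poly int}).
  rewrite -(big_imset (fun w => 'X^(des w) : {poly int}) (A := predT)) /=;
    last by move=> w w' _ _; apply: sp_rcons_inj.
  apply: eq_bigl => w.
  apply/eqP/imsetP => [<-|[w' _ ->]]; last exact: sp_last_rcons.
  by have [w' ->] := sp_rcons_surj w; exists w'; rewrite ?sp_last_rcons.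
rewrite (partition_big (@sp_last m) predT) //=; apply: eq_bigr => q _.
by rewrite mulr_suml; apply: eq_bigr => w /eqP <-; rewrite des_rcons exprD.
Qed.

(** Induction on m: one factor 1 - X takes the first difference, which [cube_count_rec] expands over
    the deleted letter exactly as [des_polyS] does; the other m + 1 factors go to the induction
    hypothesis. *)
Lemma cube_count_des_poly (m : nat) (p : 'I_m.+1 * bool) :
  fps_mul (cube_count m p.1 p.2) (fps_of_poly ((1 - 'X) ^+ m.+1)) =
  fps_of_poly (des_poly p).
Proof.
elim: m p => [|m IHm] p.
  apply/funext => n; rewrite expr1 fps_mul1BX des_poly0 /fps_of_poly coefXn.
  case: p => j b; rewrite ord1 /cube_count /= subnn !expr0 !mulr1.
  (* The series are 1, 1, 1, ... and 0, 1, 1, ..., with first differences 1 and X. *)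
  by case: b; case: n => [|[|n]]; rewrite //= expr0 !mulr1 //= ?subrr.
rewrite exprS fps_of_polyM fps_mulA.
rewrite (_ : fps_mul (cube_count _ _ _) _ = fun n => \sum_(q : 'I_m.+1 * bool)
    fps_mul (cube_count m q.1 q.2)
            (fps_of_poly 'X^(last_descent p.1 p.2 q.1 q.2)) n); last first.
  by apply/funext => n; rewrite fps_mul1BX cube_count_rec // -ltnS.
rewrite fps_mul_suml; apply/funext => n; rewrite des_polyS [RHS]/fps_of_poly coef_sum.
apply: eq_bigr => q _; rewrite -fps_mulA [fps_mul (fps_of_poly _) _]fps_mulC.
by rewrite fps_mulA IHm -fps_of_polyM.
Qed.

(** * Counting lattice points of the half-open cube *)

Lemma card_ord_ltn (N k : nat) : (k <= N)%N -> #|[pred i : 'I_N | (i < k)%N]| = k.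
Proof.
move=> le_kN; rewrite -sum1_card -(big_ord_widen _ (fun=> 1%N)) //.
by rewrite sum1_card card_ord.
Qed.

(* The point x is encoded by the function i |-> x_i + n with values in
   {0, ..., 2n}. *)
Lemma ncube_pointsE (R : realType) (d l n : nat) : (l <= d)%N ->
  ncube_points R d l n = (n.*2.+1 ^ (d - l) * n.*2 ^ l)%N.
Proof.
(* In the last l coordinates x_i = n, encoded as 2n, is excluded, which leaves 2n values. *)
move=> le_ld; pose N i := if (d - l <= i)%N then n.*2 else n.*2.+1.
pose P (i : 'I_d) := [pred k : 'I_(n.*2.+1) | (k < N i)%N].
pose f (g : {ffun 'I_d -> 'I_(n.*2.+1)}) : 'rV[R]_d := \row_i ((g i)%:R - n%:R).
have f_inj : injective f.
  move=> g g' /rowP gg'; apply/ffunP => i; apply/val_inj/eqP.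
  by have := gg' i; rewrite !mxE => /addIr/eqP; rewrite eqr_nat.
have -> : ncube_points R d l n = #|family P|.
  rewrite /ncube_points (_ : fset_set _ = [fset f g | g in family P]%fset).
    by rewrite card_imfset //= -cardE.
  apply/fsetP => x; rewrite in_fset_set; last exact: cube_points_finite.
  apply/idP/imfsetP => /= [|[g /familyP gP ->]].
    move=> /set_mem [[xn xl] xZ].
    have h i : exists k : 'I_(n.*2.+1), x ord0 i = k%:R - n%:R.
      have /andP[lo hi] := xn i; have /intrP[z xz] := xZ i.
      move: lo hi; rewrite xz -(mulrNz 1 n) !pmulrn !ler_int => lo hi.
      have zn : (`|(z + n%:Z)%R| < n.*2.+1)%N by lia.
      exists (Ordinal zn) => /=.
      by rewrite natr_absz ger0_norm ?intrD ?mulrNz ?addrK //; lia.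
    have [g gE] := choice h.
    exists [ffun i => g i]; last by apply/rowP => i; rewrite !mxE ffunE -gE.
    apply/familyP => i; rewrite ffunE inE /N; case: ifP => // le_i.
    have := ltn_ord (g i); rewrite ltnS leq_eqVlt => /orP[/eqP gi|//].
    case: xl; exists i; first by lia.
    by rewrite gE gi -addnn natrD addrK.
  apply/mem_set; split; last first.
    by move=> i; rewrite mxE rpredB // natr_int.
  split=> [i|[i le_i]]; rewrite mxE.
    rewrite lerBrDr addrC subrr ler0n lerBlDr -natrD ler_nat addnn.
    by rewrite -ltnS ltn_ord.
  move/eqP; rewrite subr_eq -natrD eqr_nat addnn => /eqP gi.
  have := gP i; rewrite inE /N gi (_ : (d - l <= i)%N) ?ltnn //; lia.
rewrite card_family foldrE big_image /= (eq_bigr (fun i : 'I_d => N i));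
  last first.
  by move=> i _; rewrite card_ord_ltn // /N; case: ifP.
rewrite -(big_mkord xpredT N) (big_cat_nat (n := (d - l)%N)) ?leq_subr //=.
congr (_ * _)%N.
  rewrite -[in RHS](subn0 (d - l)%N) -prod_nat_const_nat.
  by apply: eq_big_nat => i /andP[_ lt_i]; rewrite /N leqNgt lt_i.
rewrite -[in RHS](subKn le_ld) -prod_nat_const_nat.
by apply: eq_big_nat => i /andP[]; rewrite /N => ->.
Qed.


Theorem theorem5p2 (R : realType) (d l : nat)
    (d_ge1 : (1 <= d)%N) (l_le_d : (l <= d)%N) :
  (fun n => (ncube_points R d l n)%:Z : int) =1
  fps_div (fps_of_poly (Bpoly l.+1 d.+1))
          (fps_of_poly ((1 - 'X) ^+ d.+1)).
Proof.
have lt_d : (d - l < d.+1)%N by rewrite ltnS leq_subr.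
(* The prescribed last letter is (d + 2) - (l + 1) = (d - l) + 1, a positive letter with index d -
   l. *)
have -> : Bpoly l.+1 d.+1 = des_poly (Ordinal lt_d, false).
  apply: eq_bigl => w; rewrite sp_val_max /signed_val.
  case: (sp_last w) => [[j ltj] []] /=;
    rewrite xpair_eqE ?andbF ?andbT /= -?val_eqE /=; lia.
have {}E := cube_count_des_poly (Ordinal lt_d, false).
move=> n; rewrite -(fps_divE _ E).
  rewrite /cube_count /= subKn // ncube_pointsE // PoszM.
  by rewrite -[Posz (_ ^ (d - l))]natz -[Posz (_ ^ l)]natz !natrX -natr1 !natz.
(* The constant coefficient of the denominator is its value at 0, namely 1. *)
by rewrite /fps_of_poly -horner_coef0 !hornerE ?subr0 ?expr1n unitr1.
Qed.
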